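(* Let $p$ be an odd prime and let $\mathcal G$ be the GGS-group acting on the $p$-regular rooted tree with constant defining vector $(1,\ldots,1)$ (the GGS-group that is weakly branch but not branch). Then $\mathcal G$ has infinitely many maximal subgroups. In particular, the group $\mathcal G$ has maximal subgroups that are neither normal, nor of index $p$.
   Context: Let $p$ be an odd prime, $X=\{1,2,\ldots,p\}$, and let $T$ be the $p$-regular rooted tree, whose vertices are identified with the free monoid $X^*$. The group $\mathrm{Aut}\,T$ acts on $T$ on the right. For $f\in\mathrm{Aut}\,T$ and $u\in X^*$, the section $f_u\in\mathrm{Aut}\,T$ is defined by $(uv)^f=u^fv^{f_u}$ for all $v\in X^*$. For $f$ fixing all vertices of level $1$, write $\psi(f)=(f_1,\ldots,f_p)$ for the tuple of its first-level sections. Let $a\in\mathrm{Aut}\,T$ be the rooted automorphism permuting the first letter of each word by the $p$-cycle $(1\,2\,\cdots\,p)$ and leaving the remaining letters unchanged. The group $\mathcal G=\langle a,b\rangle\le\mathrm{Aut}\,T$ is the one where $b$ fixes all first-level vertices and is defined recursively by $\psi(b)=(a,\ldots,a,b)$. For a group $G\le \mathrm{Aut}\,T$ acting transitively on every level, $\mathrm{rist}_G(u)$ is the subgroup of elements fixing every vertex not having $u$ as a prefix, and $\mathrm{Rist}_G(n)=\prod_{|u|=n}\mathrm{rist}_G(u)$; $G$ is weakly branch if every $\mathrm{Rist}_G(n)$ is non-trivial and branch if every $\mathrm{Rist}_G(n)$ has finite index in $G$. It is known that $\mathcal G$ is weakly branch but not branch. *)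

(* Defs.v *)
From HB Require Import structures.
From mathcomp Require Import all_boot.
From mathcomp Require Import boolp classical_sets functions cardinality.

Set Implicit Arguments.
Unset Strict Implicit.
Unset Printing Implicit Defensive.

Local Open Scope classical_set_scope.
Local Open Scope group_scope.

(** * Subgroups of a possibly infinite group *)

Definition is_subgroup (gT : groupType) (H : set gT) : Prop :=
  group_closed [in H].

Definition generated (gT : groupType) (S : set gT) : set gT :=
  smallest (@is_subgroup gT) S.

Definition maximal_subgroup (gT : groupType) (G M : set gT) : Prop :=
  [/\ is_subgroup M, M `<` G &
      forall H : set gT, is_subgroup H -> M `<=` H -> H `<=` G ->
        H = M \/ H = G].

Definition is_normal (gT : groupType) (G H : set gT) : Prop :=
  forall g h : gT, G g -> H h -> H (h ^ g).

Definition right_cosets (gT : groupType) (G H : set gT) : set (set gT) :=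
  [set [set h * g | h in H] | g in G].

(* False for every [n] when the index is infinite. *)
Definition has_index (gT : groupType) (G H : set gT) (n : nat) : Prop :=
  (right_cosets G H #= `I_n)%card.

(** * The p-regular rooted tree and its automorphism group *)

(* The letter written i in {1, ..., p} is the ordinal i - 1 : 'I_p. *)
Definition word (p : nat) := seq 'I_p.

Definition adjacent (p : nat) (u v : word p) : Prop :=
  (exists x, v = rcons u x) \/ (exists x, u = rcons v x).

Record treeAut (p : nat) := TreeAut {
  tapp :> word p -> word p;
  tinv : word p -> word p;
  tappK : cancel tapp tinv;
  tinvK : cancel tinv tapp;
  tapp_root : tapp [::] = [::];
  tapp_adj : forall u v, adjacent (tapp u) (tapp v) <-> adjacent u v
}.

Lemma treeAut_ext (p : nat) (f g : treeAut p) : f =1 g -> f = g.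
Proof.
case: f g => [f f' fK f'K f0 fA] [g g' gK g'K g0 gA] /= /funext efg.
subst g; have e' : f' = g' by apply/funext => u; rewrite -{1}[u]g'K fK.
by subst g'; congr TreeAut; apply: Prop_irrelevance.
Qed.

HB.instance Definition _ (p : nat) := gen_eqMixin (treeAut p).
HB.instance Definition _ (p : nat) := gen_choiceMixin (treeAut p).

Definition treeAut_one (p : nat) : treeAut p :=
  @TreeAut p id id (fun=> erefl) (fun=> erefl) erefl
    (fun u v => iff_refl (adjacent u v)).

Lemma tinv_root (p : nat) (f : treeAut p) : tinv f [::] = [::].
Proof. by rewrite -{1}(tapp_root f) tappK. Qed.

Lemma tinv_adj (p : nat) (f : treeAut p) (u v : word p) :
  adjacent (tinv f u) (tinv f v) <-> adjacent u v.
Proof. by rewrite -(tapp_adj f) !tinvK. Qed.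

Definition treeAut_inv (p : nat) (f : treeAut p) : treeAut p :=
  TreeAut (tinvK f) (tappK f) (tinv_root f) (tinv_adj f).

Lemma tmul_root (p : nat) (f g : treeAut p) : (g \o f) [::] = [::].
Proof. by rewrite /= !tapp_root. Qed.

Lemma tmul_adj (p : nat) (f g : treeAut p) (u v : word p) :
  adjacent ((g \o f) u) ((g \o f) v) <-> adjacent u v.
Proof. by rewrite /= !tapp_adj. Qed.

(* Right action: the product [f * g] applies [f] first. *)
Definition treeAut_mul (p : nat) (f g : treeAut p) : treeAut p :=
  TreeAut (can_comp (tappK g) (tappK f)) (can_comp (tinvK f) (tinvK g))
    (tmul_root f g) (@tmul_adj p f g).

Lemma treeAut_mulA (p : nat) : associative (@treeAut_mul p).
Proof. by move=> f g h; apply: treeAut_ext. Qed.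

Lemma treeAut_mul1 (p : nat) : left_id (treeAut_one p) (@treeAut_mul p).
Proof. by move=> f; apply: treeAut_ext. Qed.

Lemma treeAut_mulr1 (p : nat) : right_id (treeAut_one p) (@treeAut_mul p).
Proof. by move=> f; apply: treeAut_ext. Qed.

Lemma treeAut_mulV (p : nat) :
  left_inverse (treeAut_one p) (@treeAut_inv p) (@treeAut_mul p).
Proof. by move=> f; apply: treeAut_ext => u /=; rewrite tinvK. Qed.

Lemma treeAut_mulrV (p : nat) :
  right_inverse (treeAut_one p) (@treeAut_inv p) (@treeAut_mul p).
Proof. by move=> f; apply: treeAut_ext => u /=; rewrite tappK. Qed.

HB.instance Definition _ (p : nat) := isGroup.Build (treeAut p)
  (@treeAut_mulA p) (@treeAut_mul1 p) (@treeAut_mulr1 p)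
  (@treeAut_mulV p) (@treeAut_mulrV p).

Definition is_section (p : nat) (f : treeAut p) (u : word p) (g : treeAut p) :
    Prop :=
  forall v : word p, f (u ++ v) = f u ++ g v.

(* [psi f = t], including the requirement that [f] fixes level 1. *)
Definition psi_eq (p : nat) (f : treeAut p) (t : 'I_p -> treeAut p) : Prop :=
  forall i : 'I_p, f [:: i] = [:: i] /\ is_section f [:: i] (t i).

(** * The generators *)

Definition child_preserving (p : nat) (f : word p -> word p) : Prop :=
  forall u x, exists y, f (rcons u x) = rcons (f u) y.

Lemma child_preserving_adj (p : nat) (f g : word p -> word p) :
    cancel f g -> child_preserving f -> child_preserving g ->
  forall u v, adjacent (f u) (f v) <-> adjacent u v.
Proof.
have imp h : child_preserving h ->
    forall u v : word p, adjacent u v -> adjacent (h u) (h v).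
  move=> hP u v [] [x ->].
    by have [y ->] := hP u x; left; exists y.
  by have [y ->] := hP v x; right; exists y.
move=> fK fP gP u v; split; last exact: imp.
by move/(imp _ gP); rewrite !fK.
Qed.

Definition rot_fun (p : nat) (s : 'I_p -> 'I_p) (u : word p) : word p :=
  if u is x :: v then s x :: v else [::].

Lemma rot_funK (p : nat) (s t : 'I_p -> 'I_p) :
  cancel s t -> cancel (rot_fun s) (rot_fun t).
Proof. by move=> sK [|x u] //=; rewrite sK. Qed.

Lemma rot_fun_child (p : nat) (s : 'I_p -> 'I_p) :
  child_preserving (rot_fun s).
Proof. by move=> [|y u] x /=; [exists (s x) | exists x]. Qed.

(* [ordS] is the cycle i |-> i + 1 mod p. *)
Definition GGS_a (p : nat) : treeAut p :=
  TreeAut (rot_funK (@ordSK p)) (rot_funK (@ord_predK p)) erefl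
    (child_preserving_adj (rot_funK (@ordSK p))
       (rot_fun_child (@ordS p)) (rot_fun_child (@ord_pred p))).

(* The last letter, i.e. the one with [i.+1 = p], keeps the recursion going. *)
Fixpoint dir_fun (p : nat) (s : 'I_p -> 'I_p) (u : seq 'I_p) : seq 'I_p :=
  if u is x :: v then
    x :: (if x.+1 == p then dir_fun s v else rot_fun s v)
  else [::].

Lemma dir_funK (p : nat) (s t : 'I_p -> 'I_p) :
  cancel s t -> cancel (dir_fun s) (dir_fun t).
Proof.
move=> sK; elim=> [|x u IH] //=.
by case: (x.+1 == p); rewrite ?IH ?(rot_funK sK).
Qed.

Lemma dir_fun_child (p : nat) (s : 'I_p -> 'I_p) :
  child_preserving (dir_fun s).
Proof.
elim=> [|y u IH] x /=; first by exists x; rewrite if_same.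
case: (y.+1 == p); first by have [z ->] := IH x; exists z.
by have [z ->] := rot_fun_child s u x; exists z.
Qed.

Definition GGS_b (p : nat) : treeAut p :=
  TreeAut (dir_funK (@ordSK p)) (dir_funK (@ord_predK p)) erefl
    (child_preserving_adj (dir_funK (@ordSK p))
       (dir_fun_child (@ordS p)) (dir_fun_child (@ord_pred p))).

(* [GGS_b] is the unique solution of psi(b) = (a, ..., a, b). *)
Lemma GGS_bP (p : nat) (f : treeAut p) :
  psi_eq f (fun i => if i.+1 == p then f else GGS_a p) <-> f = GGS_b p.
Proof.
split=> [fP | ->]; last first.
  by move=> i; split=> [|v] /=; case: ifP.
apply: treeAut_ext; elim=> [|x u IH]; first exact: tapp_root.
have [fx /(_ u)] := fP x; rewrite fx /= => ->.
by case: ifP => _ //=; rewrite IH.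
Qed.

Definition GGS_group (p : nat) : set (treeAut p) :=
  generated [set GGS_a p; GGS_b p].

Arguments GGS_group p : clear implicits.

(* Main.v *)
(** Let [F] be a field with an element [z] such that [1 + z + ... + z^(p-1) = 0].
On words in [a] and [b], let [D] be the crossed homomorphism
[D (u v) = D u + z^|u| D v] with [D a = 0] and [D b = 1].  Because [b] has
sections [a, ..., a, b], it satisfies [D w = \sum_i z^(p-i) D (w_i)] (with
[i] in [1..p]), where [w_i] is the word for the section of [w] at [i]; by
induction on the number of letters [b], words acting trivially on the tree have
[D w = 0] and length divisible by [p].  Hence [D] is defined on the group, which
acts on [F] by the affine maps [x |-> z^|g| x + D g].  For [F = F_q] with
[q > p] prime, the stabiliser [D = 0] of the point [0] is maximal, of index [q]
and not normal since [z <> 1].  Such [q] are the prime factors of the values of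
the [p]-th cyclotomic polynomial, so there are infinitely many of them, and [q]
can be read off the stabiliser: [(b a^-1)^n] belongs to it iff [q] divides [n]. *)

Require Import Defs.
From mathcomp Require Import all_boot.
From mathcomp Require Import ssralg zmodp.
From mathcomp Require Import boolp classical_sets functions cardinality.

Set Implicit Arguments.
Unset Strict Implicit.
Unset Printing Implicit Defensive.

Import GRing.Theory.

(** * Positive words, their sections and their values in the group *)

Section Words.
Variable p : nat.
Local Open Scope group_scope.

(* [true] stands for [b] and [false] for [a]. As both generators have finite
   order, every element of the group is a positive word. *)
Definition letter_eval (x : bool) : treeAut p := if x then GGS_b p else GGS_a p.

Definition word_eval (w : seq bool) : treeAut p :=
  foldr (fun x f => letter_eval x * f) 1 w.

Fixpoint section_word (i : 'I_p) (w : seq bool) : seq bool :=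
  if w is x :: w' then
    if x then (i.+1 == p) :: section_word i w' else section_word (ordS i) w'
  else [::].

Lemma word_eval_cat (u v : seq bool) :
  word_eval (u ++ v) = word_eval u * word_eval v.
Proof. by elim: u => [|x u IH] /=; rewrite ?mul1g // IH mulgA. Qed.

Lemma word_eval_nseq (n : nat) (x : bool) :
  word_eval (nseq n x) = letter_eval x ^+ n.
Proof. by elim: n => //= n ->; rewrite expgS. Qed.

Lemma word_eval_section (w : seq bool) (i : 'I_p) (v : word p) :
  word_eval w (i :: v) =
  iter (count negb w) (@ordS p) i :: word_eval (section_word i w) v.
Proof.
elim: w i v => [|[] w IH] i v //=.
  by rewrite /letter_eval IH; case: ifP.
by rewrite IH -iterSr.
Qed.

Lemma section_word_eval1 (w : seq bool) (i : 'I_p) :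
  word_eval w = 1 -> word_eval (section_word i w) = 1.
Proof.
move=> w1; apply: treeAut_ext => v.
by have := word_eval_section w i v; rewrite w1 => -[].
Qed.

Lemma size_section_word (w : seq bool) (i : 'I_p) :
  size (section_word i w) = count id w.
Proof. by elim: w i => [|[] w IH] i //=; rewrite IH. Qed.

Lemma section_word_nseqT (n : nat) (i : 'I_p) :
  section_word i (nseq n true) = nseq n (i.+1 == p).
Proof. by elim: n => //= n ->. Qed.

Lemma section_word_nseqF (n : nat) (i : 'I_p) :
  section_word i (nseq n false) = [::].
Proof. by elim: n i => /=. Qed.

Lemma iter_ordS (n : nat) (i : 'I_p) :
  iter n (@ordS p) i = (i + n) %% p :> nat.
Proof.
elim: n => [|n IH] /=; first by rewrite addn0 modn_small.
by rewrite IH -addn1 modnDml addn1 addnS.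
Qed.

Lemma dvdn_count_a (w : seq bool) (p_gt0 : 0 < p) :
  word_eval w = 1 -> p %| count negb w.
Proof.
move=> w1; pose i0 := Ordinal p_gt0.
have := word_eval_section w i0 [::]; rewrite w1 => -[] /(congr1 val) /=.
by rewrite iter_ordS add0n => /esym /eqP.
Qed.

(** Each letter of the section stems from one [b] of [w]; if the count does not drop, all of them
    are [b] again. *)
Lemma count_b_section_lt (w : seq bool) (i : 'I_p) :
  section_word i w = nseq (count id w) true \/
  count id (section_word i w) < count id w.
Proof.
have := count_size id (section_word i w); rewrite size_section_word.
rewrite leq_eqVlt => /orP[/eqP e|]; [left | by right].
rewrite -(size_section_word w i); apply/all_pred1P.
have : all id (section_word i w) by rewrite all_count e size_section_word.
by move/sub_all; apply=> -[].
Qed.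

(** Induction along the vertex: the first-level sections of b^p are a^p or b^p, those of a^p are
    trivial. *)
Lemma letter_eval_expp (x : bool) : letter_eval x ^+ p = 1.
Proof.
apply: treeAut_ext => v; rewrite -word_eval_nseq.
elim: v x => [|i v IH] x; first exact: tapp_root.
rewrite word_eval_section.
have -> : iter (count negb (nseq p x)) (@ordS p) i = i.
  apply: val_inj; rewrite /= iter_ordS count_nseq.
  by case: x; rewrite ?muln1 ?muln0 ?addn0 ?mul0n ?mul1n ?modnDr modn_small.
by case: x => /=; rewrite ?section_word_nseqT ?section_word_nseqF ?IH.
Qed.

Lemma word_eval_inv (w : seq bool) (p_gt0 : 0 < p) :
  exists v, word_eval v = (word_eval w)^-1.
Proof.
elim: w => [|x w [v vP]]; first by exists [::]; rewrite invg1.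
exists (v ++ nseq p.-1 x); rewrite word_eval_cat vP word_eval_nseq /= invgM.
congr (_ * _); apply: (mulgI (letter_eval x)).
by rewrite -expgS prednK // letter_eval_expp mulgV.
Qed.

Lemma GGS_groupE (p_gt0 : 0 < p) : GGS_group p = range word_eval.
Proof.
apply/seteqP; split.
  apply: smallest_sub => [|f [] ->].
  - split; first by rewrite inE; exists [::].
    move=> f g; rewrite !inE => -[u _ <-] [v _ <-].
    have [v' v'P] := word_eval_inv v p_gt0.
    by exists (u ++ v') => //; rewrite word_eval_cat v'P.
  - by exists [:: false] => //=; rewrite mulg1.
  - by exists [:: true] => //=; rewrite mulg1.
move=> _ [w _ <-] H [Hgrp HS].
have HM := group_closedM Hgrp.
elim: w => [|x w IH] /=; first by have [] := Hgrp; rewrite inE.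
have Hx : H (letter_eval x) by apply: HS; case: x; [right|left].
by have := HM (letter_eval x) (word_eval w); rewrite !inE; apply.
Qed.

End Words.

(** * The crossed homomorphism and the stabiliser of 0 *)

Section Cocycle.
Variables (p : nat) (F : fieldType) (z : F).
Hypotheses (p_prime : prime p) (z_sum : (\sum_(i < p) z ^+ i = 0)%R).
Local Open Scope ring_scope.

Let p_gt0 : (0 < p)%N := prime_gt0 p_prime.

(* The crossed homomorphism [D (u v) = D u + z ^ |u| * D v] with [D a = 0] and
   [D b = 1]: the group acts on [F] by affine maps whose translation part at
   [w] is [D w]. *)
Fixpoint cocycle (w : seq bool) : F :=
  if w is x :: w' then x%:R + z * cocycle w' else 0.

Lemma expr_root : z ^+ p = 1.
Proof. by apply/eqP; rewrite -subr_eq0 subrX1 z_sum mulr0. Qed.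

Lemma expr_root_dvd (n : nat) : (p %| n)%N -> z ^+ n = 1.
Proof. by case/dvdnP=> k ->; rewrite mulnC exprM expr_root expr1n. Qed.

Lemma cocycle_cat (u v : seq bool) :
  cocycle (u ++ v) = cocycle u + z ^+ size u * cocycle v.
Proof.
elim: u => [|x u IH] /=; first by rewrite expr0 mul1r add0r.
by rewrite IH exprS mulrDr addrA mulrA.
Qed.

Lemma cocycle_nseqF (n : nat) : cocycle (nseq n false) = 0.
Proof. by elim: n => //= n ->; rewrite mulr0 addr0. Qed.

Lemma cocycle_nseqT (n : nat) : cocycle (nseq n true) = \sum_(i < n) z ^+ i.
Proof.
elim: n => [|n IH] /=; first by rewrite big_ord0.
rewrite big_ord_recl /= expr0 IH mulr_sumr; congr (_ + _).
by apply: eq_bigr => i _; rewrite exprS.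
Qed.

Lemma cocycle_nseqT_dvd (n : nat) : (p %| n)%N -> cocycle (nseq n true) = 0.
Proof.
case/dvdnP=> k ->; elim: k => [|k IH]; first by rewrite mul0n.
by rewrite mulSn nseqD cocycle_cat IH mulr0 addr0 cocycle_nseqT.
Qed.

Lemma cocycle_section (w : seq bool) :
  cocycle w = \sum_(i < p) z ^+ rev_ord i * cocycle (section_word i w).
Proof.
elim: w => [|[] w IH] /=.
- by rewrite big1 // => i _; rewrite mulr0.
- under eq_bigr => i _ do rewrite mulrDr mulrCA.
  rewrite big_split /= -mulr_sumr -IH; congr (_ + _).
  (* Only the section at the last index [m] starts with [b], and its weight is z^0 = 1. *)
  pose m := rev_ord (Ordinal p_gt0).
  have m1 : m.+1 = p by rewrite /= subn1 prednK.
  rewrite (bigD1 m) //= m1 eqxx subnn expr0 mulr1 big1 ?addr0 // => i ne_im.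
  by rewrite -[X in _ == X]m1 eqSS val_eqE (negbTE ne_im) mulr0.
- rewrite add0r IH mulr_sumr (reindex_inj (@ordS_inj p)) /=.
  apply: eq_bigr => i _; rewrite mulrA -exprS; congr (_ * _).
  (* At the last index the cycle wraps around to 0, where z^p = 1 closes the gap between the
     weights. *)
  have := ltn_ord i; rewrite leq_eqVlt => /orP[/eqP ip|ip].
    by rewrite ip modnn subnn subn1 prednK // expr_root.
  by rewrite modn_small // subnSK.
Qed.

(* Sections carry fewer letters [b] unless they are powers of [b], so induction
   on the number of letters [b] applies. *)
Lemma word_eval1_cocycle (w : seq bool) :
  word_eval p w = 1%g -> cocycle w = 0 /\ (p %| size w)%N.
Proof.
have [n] := ubnP (count id w); elim: n w => // n IH w; rewrite ltnS => wn w1.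
have sec (i : 'I_p) :
    cocycle (section_word i w) = 0 /\ (p %| size (section_word i w))%N.
  have s1 := section_word_eval1 i w1.
  have [e|lt_w] := count_b_section_lt w i; last first.
    by apply: IH => //; apply: leq_trans lt_w wn.
  rewrite e in s1 *.
  (* The section is now a power b^n; its own section at the first letter is a^n, again trivial,
     which forces p to divide n. *)
  have := section_word_eval1 (Ordinal p_gt0) s1.
  rewrite section_word_nseqT /= eq_sym gtn_eqF ?prime_gt1 //.
  move/(dvdn_count_a p_gt0); rewrite count_nseq mul1n => pdvd.
  by rewrite cocycle_nseqT_dvd // size_nseq.
split; first by rewrite cocycle_section big1 // => i _; rewrite (sec i).1 mulr0.
rewrite -(count_predC id) dvdn_addr ?(dvdn_count_a p_gt0 w1) //.
by rewrite -(size_section_word w (Ordinal p_gt0)); case: (sec (Ordinal p_gt0)).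
Qed.

(** Appending a word for the inverse of the common value turns both [u] and [v] into trivial
    words. *)
Lemma word_eval_cocycle (u v : seq bool) : word_eval p u = word_eval p v ->
  cocycle u = cocycle v /\ z ^+ size u = z ^+ size v.
Proof.
have [v' v'P] := word_eval_inv v p_gt0.
have inv_v' t : word_eval p t = word_eval p v ->
    cocycle t + z ^+ size t * cocycle v' = 0 /\ z ^+ size t * z ^+ size v' = 1.
  move=> tv; have /word_eval1_cocycle[] : word_eval p (t ++ v') = 1%g.
    by rewrite word_eval_cat v'P tv mulgV.
  by rewrite cocycle_cat size_cat => -> /expr_root_dvd; rewrite exprD.
move=> uv; have [Du Su] := inv_v' u uv; have [Dv Sv] := inv_v' v erefl.
have Suv : z ^+ size u = z ^+ size v.
  by rewrite -[LHS]mulr1 -Sv mulrCA Su mulr1.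
by split=> //; rewrite Suv -Dv in Du; apply: addIr Du.
Qed.

Lemma root_neq0 : z != 0.
Proof.
by apply/eqP => z0; move: expr_root (oner_neq0 F);
  rewrite z0 expr0n eqn0Ngt p_gt0 => <-; rewrite eqxx.
Qed.

Definition cocycle_kernel : set (treeAut p) :=
  [set word_eval p w | w in [set w | cocycle w = 0]]%classic.

Lemma cocycle_kernelP (w : seq bool) :
  cocycle_kernel (word_eval p w) <-> cocycle w = 0.
Proof.
split=> [[v /= v0 /word_eval_cocycle[<-]] //|w0].
by exists w.
Qed.

Lemma cocycle_kernel_subgroup : is_subgroup cocycle_kernel.
Proof.
split; first by rewrite inE; exists [::].
move=> f g; rewrite !inE => -[u /= u0 <-] [v /= v0 <-].
have [v' v'P] := word_eval_inv v p_gt0; rewrite -v'P -word_eval_cat.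
apply/cocycle_kernelP; rewrite cocycle_cat u0 add0r.
have : word_eval p (v ++ v') = 1%g by rewrite word_eval_cat v'P mulgV.
move/word_eval1_cocycle => [/eqP]; rewrite cocycle_cat v0 add0r mulf_eq0.
by rewrite expf_eq0 (negbTE root_neq0) andbF => /eqP ->; rewrite mulr0.
Qed.

Lemma cocycle_kernel_sub : (cocycle_kernel `<=` GGS_group p)%classic.
Proof. by rewrite GGS_groupE // => _ [w _ <-]; exists w. Qed.

(* The word [(b a^-1)^n], which acts on [F] as the translation by [n]. *)
Definition translation_word (n : nat) : seq bool :=
  iter n (cat (true :: nseq p.-1 false)) [::].

Lemma cocycle_translation_word (n : nat) :
  cocycle (translation_word n) = n%:R.
Proof.
elim: n => //= n IH; rewrite cocycle_cat cocycle_nseqF size_nseq add0r IH mulrA.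
by rewrite -exprS prednK // expr_root mul1r nat1r.
Qed.

Lemma cocycle_kernel_proper : (cocycle_kernel `<` GGS_group p)%classic.
Proof.
split; first exact: cocycle_kernel_sub.
rewrite GGS_groupE // => /(_ (word_eval p [:: true])) /(_ (ex_intro2 _ _ _ I erefl)).
by move/cocycle_kernelP/eqP; rewrite /= mulr0 addr0 oner_eq0.
Qed.

(** If the conjugate of a by b had a word [w] of cocycle 0, the words b w and a b would have the
    same value, but their cocycles are 1 and z. *)
Lemma cocycle_kernel_not_normal : z != 1 ->
  ~ is_normal (GGS_group p) cocycle_kernel.
Proof.
move=> z_neq1 /(_ (word_eval p [:: true]) (word_eval p [:: false])).
have Gb : GGS_group p (word_eval p [:: true]).
  by rewrite GGS_groupE //; exists [:: true].
have Ma : cocycle_kernel (word_eval p [:: false]).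
  by apply/cocycle_kernelP; rewrite /= mulr0 addr0.
move/(_ Gb Ma) => [w /= w0 wE].
have := conjgC (word_eval p [:: false]) (word_eval p [:: true]).
rewrite -wE -!word_eval_cat => /word_eval_cocycle[+ _].
by rewrite /= w0 !mulr0 !addr0 add0r mulr1 => /eqP; rewrite (negbTE z_neq1).
Qed.

(* In a prime field every nonzero translation generates all translations. *)
Lemma cocycle_kernel_maximal :
  (forall c d : F, c != 0 -> exists n, c *+ n = d) ->
  maximal_subgroup (GGS_group p) cocycle_kernel.
Proof.
move=> prime_field; split; first exact: cocycle_kernel_subgroup.
  exact: cocycle_kernel_proper.
move=> H Hgrp MH HG; have [HM|] := pselect (H `<=` cocycle_kernel)%classic.
  by left; apply/seteqP.
move/existsNP=> [h /not_implyP[Hh]]; rewrite GGS_groupE // in HG *.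
have [w _ wh] := HG _ Hh; rewrite -{}wh in Hh * => /cocycle_kernelP/eqP c_neq0.
right; apply/seteqP; split=> // _ [u _ <-].
have HMul x y : H x -> H y -> H (x * y)%g.
  by have := group_closedM Hgrp; move=> /(_ x y); rewrite !inE.
have HDiv x y : H x -> H y -> H (x / y)%g.
  by have := Hgrp.2; move=> /(_ x y); rewrite !inE.
(* Padding with letters a, which lie in the kernel, makes the length a multiple of [p]: [w1] acts as
   the translation by [cocycle w]. *)
pose w1 := w ++ nseq (size w * p.-1) false.
have Hw1 : H (word_eval p w1).
  rewrite word_eval_cat; apply: HMul => //; apply/MH/cocycle_kernelP.
  exact: cocycle_nseqF.
have Dw1 : cocycle w1 = cocycle w.
  by rewrite cocycle_cat cocycle_nseqF mulr0 addr0.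
have Sw1 : z ^+ size w1 = 1.
  apply: expr_root_dvd; rewrite size_cat size_nseq -mulnS prednK //.
  exact: dvdn_mull.
(* With this [n] the word [wn ++ u] has cocycle 0, so its value lies in [H]; cancelling [wn] leaves
   [u]. *)
have [n nE] := prime_field _ (- cocycle u) c_neq0.
pose wn := iter n (cat w1) [::].
have Hwn : H (word_eval p wn).
  rewrite /wn; elim: (n) => [|k IH]; last first.
    by rewrite [iter _ _ _]/= word_eval_cat; exact: HMul.
  by apply/MH/cocycle_kernelP.
have [Dwn Swn] : cocycle wn = cocycle w *+ n /\ z ^+ size wn = 1.
  rewrite /wn; elim: (n) => [|k [IHD IHS]] //=.
  by rewrite cocycle_cat size_cat exprD Sw1 IHS Dw1 IHD !mul1r mulrS.
have Hwnu : H (word_eval p (wn ++ u)).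
  by apply/MH/cocycle_kernelP; rewrite cocycle_cat Swn mul1r Dwn nE addNr.
have Hinv : H (word_eval p wn)^-1%g 
  by have := group_closedV Hgrp => /(_ (word_eval p wn)); rewrite !inE; apply.
by have := HMul _ _ Hinv Hwnu; rewrite word_eval_cat mulKg.
Qed.

End Cocycle.

Arguments cocycle_kernel p {F} z.

(** * Infinitely many suitable prime fields, and the subgroups they give *)

Section PrimeField.
Local Open Scope ring_scope.

Definition cyclotomic_prime (p : nat) : set nat :=
  [set q | [/\ prime q, (p < q)%N &
              exists z : 'F_q, \sum_(i < p) z ^+ i = 0]]%classic.

#[global] Arguments cyclotomic_prime p : clear implicits.

(* Any prime factor of the value at [N!] of the [p]-th cyclotomic polynomial
   exceeds [N]. *)
Lemma cyclotomic_prime_unbounded (p N : nat) : prime p ->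
  exists2 q, cyclotomic_prime p q & (N < q)%N.
Proof.
(* Taking the maximum with [p] also ensures p < q. *)
move=> p_prime; pose x := (maxn N p)`!.
pose S := (\sum_(i < p) x ^ i)%N; pose q := pdiv S.
have p_gt1 := prime_gt1 p_prime.
have SE : S = (1 + x * \sum_(i < p.-1) x ^ i)%N.
  rewrite /S; case: (p) p_gt1 => // n _; rewrite big_ord_recl expn0 big_distrr /=.
  by congr (_ + _)%N; apply: eq_bigr => i _; rewrite -expnS.
have q_prime : prime q.
  apply: pdiv_prime; rewrite SE ltnS muln_gt0 fact_gt0 /=.
  by case: (p) p_gt1 => [|[|n]] //= _; rewrite big_ord_recl.
have q_gt : (maxn N p < q)%N.
  rewrite ltnNge; apply/negP => q_le.
  have := pdiv_dvd S; rewrite -/q SE dvdn_addl ?dvdn1; last first.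
    by apply: dvdn_mulr; rewrite dvdn_fact // prime_gt0.
  by rewrite gtn_eqF // prime_gt1.
exists q; last by apply: leq_ltn_trans q_gt; rewrite leq_maxl.
split=> //; first by apply: leq_ltn_trans q_gt; rewrite leq_maxr.
exists x%:R; under eq_bigr => i _ do rewrite -natrX.
by rewrite -natr_sum; apply/eqP; rewrite -(dvdn_pcharf (pchar_Fp q_prime)) pdiv_dvd.
Qed.

Lemma Fp_multiple (q : nat) (c d : 'F_q) : c != 0 -> exists n, c *+ n = d.
Proof.
(* The quotient in the field, read as a natural number. *)
move=> c_neq0; exists (d / c : 'F_q).
by rewrite -mulr_natr natr_Zp mulrC divfK.
Qed.

(** At z = 1 the sum is [p], which is nonzero modulo the larger prime [q]. *)
Lemma cyclotomic_root_neq1 (p q : nat) (z : 'F_q) :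
  prime p -> prime q -> (p < q)%N -> \sum_(i < p) z ^+ i = 0 -> z != 1.
Proof.
move=> p_prime q_prime lt_pq z_sum; apply/eqP => z1.
move/eqP: z_sum; rewrite z1; under eq_bigr => i _ do rewrite expr1n.
rewrite sumr_const card_ord -(dvdn_pcharf (pchar_Fp q_prime)).
by move/(dvdn_leq (prime_gt0 p_prime)); rewrite leqNgt lt_pq.
Qed.

(** The translations by 0, ..., q - 1 lie in distinct cosets, so there are at least q > p of
    them. *)
Lemma cocycle_kernel_not_index (p q : nat) (z : 'F_q) :
  prime p -> prime q -> (p < q)%N -> \sum_(i < p) z ^+ i = 0 ->
  ~ has_index (GGS_group p) (cocycle_kernel p z) p.
Proof.
move=> p_prime q_prime lt_pq z_sum idx_p; pose M := cocycle_kernel p z.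
pose t k := word_eval p (translation_word p k).
pose coset k := ([set h * t k | h in M]%g)%classic.
have coset_inj : {in `I_q%classic &, injective coset}.
  move=> k l; rewrite !inE /= => lt_kq lt_lq ekl.
  have : coset k (t k).
    exists 1%g; last by rewrite mul1g.
    by apply/(cocycle_kernelP p_prime z_sum [::]).
  rewrite ekl => -[_ [w /= w0 <-]]; rewrite -word_eval_cat.
  move/(word_eval_cocycle p_prime z_sum) => [].
  rewrite cocycle_cat size_cat exprD w0 add0r.
  rewrite !(cocycle_translation_word p_prime z_sum).
  have size_t n : z ^+ size (translation_word p n) = 1.
    apply: (expr_root_dvd z_sum); elim: n => //= n IH.
    by rewrite size_cat size_nseq -addSn prednK ?prime_gt0 // dvdn_addr.
  rewrite !size_t mulr1 => + Sw; rewrite Sw mul1r => /(congr1 val) /=.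
  by rewrite !val_Fp_nat // !modn_small.
have : (`I_q #<= right_cosets (GGS_group p) M)%card.
  apply: (card_le_trans _ (subset_card_le (A := [set coset k | k in `I_q]%classic) _)).
    by have := inj_card_eq coset_inj; rewrite card_eq_le => /andP[].
  move=> _ [k _ <-]; exists (t k) => //.
  by rewrite GGS_groupE ?prime_gt0 //; exists (translation_word p k).
move=> /card_le_trans; move: idx_p; rewrite /has_index card_eq_le => /andP[le_p _].
by move/(_ _ _ le_p); rewrite card_le_II leqNgt lt_pq.
Qed.

(** Choosing a root makes the subgroup a function of [q] alone; the default 0 is taken only when
    there is no root. *)
Definition cyclotomic_subgroup (p q : nat) : set (treeAut p) :=
  cocycle_kernel p (xget 0 [set z : 'F_q | \sum_(i < p) z ^+ i = 0]%classic).

#[global] Arguments cyclotomic_subgroup p q : clear implicits.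

Lemma cyclotomic_subgroup_root (p q : nat) : cyclotomic_prime p q ->
  exists2 z : 'F_q, cyclotomic_subgroup p q = cocycle_kernel p z &
    \sum_(i < p) z ^+ i = 0.
Proof. by move=> [_ _ ex_z]; eexists; [reflexivity|exact: (xgetPex 0 ex_z)]. Qed.

(** The element (b a^-1)^q lies in the subgroup for [q]; lying in the one for [r] as well, it forces
    r to divide q. *)
Lemma cyclotomic_subgroup_inj (p : nat) : prime p ->
  {in cyclotomic_prime p &, injective (cyclotomic_subgroup p)}.
Proof.
move=> p_prime q r; rewrite !inE => q_cyc r_cyc.
have [[q_prime _ _] [r_prime _ _]] := (q_cyc, r_cyc).
have [[zq -> zq_sum] [zr -> zr_sum]] :=
  (cyclotomic_subgroup_root q_cyc, cyclotomic_subgroup_root r_cyc).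
move=> eM; have : cocycle_kernel p zq (word_eval p (translation_word p q)).
  apply/(cocycle_kernelP p_prime zq_sum).
  rewrite (cocycle_translation_word p_prime zq_sum); apply/eqP.
  by rewrite -(dvdn_pcharf (pchar_Fp q_prime)).
rewrite eM => /(cocycle_kernelP p_prime zr_sum).
rewrite (cocycle_translation_word p_prime zr_sum) => /eqP.
by rewrite -(dvdn_pcharf (pchar_Fp r_prime)) dvdn_prime2 // => /eqP.
Qed.

Lemma cyclotomic_subgroup_maximal (p q : nat) :
  prime p -> cyclotomic_prime p q ->
  maximal_subgroup (GGS_group p) (cyclotomic_subgroup p q).
Proof.
move=> p_prime /cyclotomic_subgroup_root[z -> z_sum].
by apply: (cocycle_kernel_maximal p_prime z_sum); exact: Fp_multiple.
Qed.

End PrimeField.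

Theorem proposition5p11 (p : nat) (p_prime : prime p) (p_odd : odd p) :
  infinite_set [set M | maximal_subgroup (GGS_group p) M]%classic /\
  exists M : set (treeAut p),
    [/\ maximal_subgroup (GGS_group p) M,
        ~ is_normal (GGS_group p) M &
        ~ has_index (GGS_group p) M p].
Proof.
split; last first.
  have [q q_cyc _] := cyclotomic_prime_unbounded 0 p_prime.
  have [q_prime lt_pq _] := q_cyc.
  exists (cyclotomic_subgroup p q).
  split; first exact: cyclotomic_subgroup_maximal.
    have [z -> z_sum] := cyclotomic_subgroup_root q_cyc.
    apply: (cocycle_kernel_not_normal p_prime z_sum).
    exact: cyclotomic_root_neq1 lt_pq z_sum.
  have [z -> z_sum] := cyclotomic_subgroup_root q_cyc.
  exact: cocycle_kernel_not_index lt_pq z_sum.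
move=> max_fin.
have /finite_seqP[s sE] : finite_set (cyclotomic_prime p).
  rewrite -(eq_finite_set (inj_card_eq (cyclotomic_subgroup_inj p_prime))).
  apply: sub_finite_set max_fin => _ [q q_cyc <-].
  exact: cyclotomic_subgroup_maximal.
(* A prime beyond the maximum of the supposed finite list [s] gives the contradiction. *)
have [q q_cyc] := cyclotomic_prime_unbounded (\max_(i <- s) i) p_prime.
rewrite ltnNge => /negP[]; apply: (@leq_bigmax_seq _ s xpredT id q) => //.
by move: q_cyc; rewrite sE.
Qed.
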